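(* Let $Q(x,y,z)$ be an irreducible complex quadratic form. For any $d\ge2$, there is a family of (nonzero homogeneous) polynomial functions of degree $d$ on the quadratic surface $\{Q=0\}$ which is parameterized by a $5$-dimensional disk $D^5$, i.e. a continuous map $h:D^5\to V_Q^\perp(d)^\circ$, which does not admit a continuous lifting to the multipole space $\mathcal M(d)$ (with respect to $\Phi_Q:\mathcal M(d)\to V_Q^\perp(d)^\circ$). At the same time, the functions parameterized by the $4$-sphere forming the boundary of the disk can be continuously represented by multipoles, i.e. $h|_{\partial D^5}$ admits a continuous lifting to $\mathcal M(d)$.
   Context: $V(d)$ is the space of homogeneous complex polynomials of degree $d$ in $x,y,z$; $V_Q(d)=Q\cdot V(d-2)$; $V_Q^\perp(d)$ is the orthogonal complement of $V_Q(d)$ for a Hermitian inner product, identified with $V(d)/V_Q(d)$, the homogeneous degree $d$ polynomial functions on the cone $\{Q=0\}\subset\mathbb C^3$. $V^\circ=V\setminus\{0\}$. $\mathcal M(d)=[V(1)^\circ]^d/\Sigma_d$, where $\Sigma_d$ is the group generated by permutations and by rescalings $(L_i)\mapsto(\lambda_iL_i)$, $\lambda_i\in\mathbb C^\ast$, $\prod\lambda_i=1$. $\Phi_Q$ sends the class of $(L_1,\dots,L_d)$ to the class of $\prod L_i$ modulo $Q$. *)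

(* Defs.v *)
(* MathComp and MathComp-Analysis, with multinomials for the polynomials. *)
From HB Require Import structures.
From mathcomp Require Import all_boot all_order all_algebra perm.
From Stdlib Require Import Relation_Operators.
From mathcomp Require Import sesquilinear complex.
From mathcomp Require Import all_classical reals topology normedtype.
From mathcomp Require mpoly.
(* The notations of mpoly clash with those of MathComp-Analysis. *)
Export -(notations) mpoly.

Set Implicit Arguments.
Unset Strict Implicit.
Unset Printing Implicit Defensive.

Import Order.TTheory GRing.Theory Num.Theory.
Import numFieldNormedType.Exports.

Local Open Scope classical_set_scope.
Local Open Scope quotient_scope.
Local Open Scope ring_scope.

Definition irreducible_elt (A : unitRingType) (a : A) : Prop :=
  [/\ a != 0, a \isn't a GRing.unit &
      forall b c : A, a = b * c -> b \is a GRing.unit \/ c \is a GRing.unit].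

Section Multipoles.
Variable K : numClosedFieldType.

Definition V (d : nat) : Type := dhomog 3 K d.

HB.instance Definition _ (d : nat) := Vector.copy (V d) (dhomog 3 K d).

Definition poly_of (d : nat) (p : V d) : mpoly 3 K := mpoly_of_dhomog p.

(* V d is topologized as a finite-dimensional K-vector space: a map into V d is
   continuous iff all the coefficients (indexed by the exponents m) are. *)
Definition coefs (d : nat) (p : V d) : prod_topology (fun _ : multinom 3 => K) :=
  fun m => mcoeff m (poly_of p).

HB.instance Definition _ (d : nat) :=
  Topological.copy (V d) (initial_topology (@coefs d)).

(* For 2 <= d the product below is homogeneous of degree d, so that indhomog
   does not alter it; see mulQE and mem_VQ. *)
Definition mulQ (Q : V 2) (d : nat) (p : V (d - 2)) : V d :=
  indhomog d (poly_of Q * poly_of p).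

Definition VQ (Q : V 2) (d : nat) : {vspace V d} := limg (linfun (@mulQ Q d)).

Lemma indhomogK (d : nat) (p : mpoly 3 K) :
  p \is ishomog1 d mdeg -> poly_of (indhomog d p) = p.
Proof. by move=> hp; rewrite /poly_of /indhomog insubdK. Qed.

Lemma mulQE (Q : V 2) (d : nat) (p : V (d - 2)) : (2 <= d)%N ->
  poly_of (mulQ Q p) = poly_of Q * poly_of p.
Proof.
move=> d2; apply: indhomogK; rewrite -[X in ishomog1 X](subnKC d2).
by apply: dhomogM; apply: dhomog_is_dhomog.
Qed.

Lemma mulQ_linear (Q : V 2) (d : nat) : (2 <= d)%N -> linear (@mulQ Q d).
Proof.
move=> d2 c p q; apply: val_inj.
change (poly_of (mulQ Q (c *: p + q)) =
  c *: poly_of (mulQ Q p) + poly_of (mulQ Q q)).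
rewrite !mulQE // -[poly_of (c *: p + q)]/(c *: poly_of p + poly_of q).
by rewrite mulrDr scalerAr.
Qed.

Lemma mem_VQ (Q : V 2) (d : nat) (p : V d) : (2 <= d)%N ->
  p \in VQ Q d <-> exists q : V (d - 2), poly_of p = poly_of Q * poly_of q.
Proof.
move=> d2; pose HL := GRing.isLinear.Build _ _ _ _ _ (mulQ_linear Q d2).
pose f : {linear V (d - 2) -> V d} := HB.pack (@mulQ Q d) HL.
have lE q : linfun (@mulQ Q d) q = mulQ Q q by exact: (lfunE f q).
split=> [/memv_imgP[q _ ->]|[q pE]]; first by exists q; rewrite lE mulQE.
apply/memv_imgP; exists q; rewrite ?memvf // lE.
by apply: val_inj; rewrite -[LHS]/(poly_of p) pE -mulQE.
Qed.

Definition VQperp (d : nat) (ip : {dot V d for Num.conj}) (Q : V 2) :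
  {vspace V d} := orthov ip (VQ Q d).

Definition V1o : Type := set_type [set L : V 1 | L != 0].
HB.instance Definition _ := Topological.on V1o.

Definition linform (L : V1o) : V 1 := set_val L.

Definition multituple (d : nat) : Type := prod_topology (fun _ : 'I_d => V1o).
HB.instance Definition _ (d : nat) := Topological.on (multituple d).

Definition perm_step (d : nat) (L L' : multituple d) : Prop :=
  exists s : {perm 'I_d}, forall i, L' i = L (s i).

Definition scale_step (d : nat) (L L' : multituple d) : Prop :=
  exists2 lam : 'I_d -> K, \prod_i lam i = 1 &
    forall i, linform (L' i) = lam i *: linform (L i).

(* L and L' are in the same orbit of the group Sigma_d generated by the
   permutations and the rescalings. The latter are normalized by the former,
   hence the shape below; see sigma_relP. That no lam i vanishes follows from
   the value of the product. *)
Definition sigma_rel (d : nat) (L L' : multituple d) : Prop :=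
  exists (s : {perm 'I_d}) (lam : 'I_d -> K),
    \prod_i lam i = 1 /\
    forall i, linform (L' i) = lam i *: linform (L (s i)).

Lemma linform_inj : injective linform.
Proof. exact: val_inj. Qed.

Lemma linform_neq0 (L : V1o) : linform L != 0.
Proof. exact: (set_mem (valP L)). Qed.

Lemma sigma_rel_refl (d : nat) (L : multituple d) : sigma_rel L L.
Proof.
exists 1%g, (fun=> 1); split=> [|i]; first by rewrite big1.
by rewrite perm1 scale1r.
Qed.

Lemma sigma_rel_sym (d : nat) (L L' : multituple d) :
  sigma_rel L L' -> sigma_rel L' L.
Proof.
move=> [s [lam [lam1 LL']]].
have lam0 i : lam i != 0.
  have /prodf_neq0 /(_ i isT) // : \prod_i lam i != 0.
  by rewrite lam1 oner_eq0.
exists s^-1%g, (fun i => (lam (s^-1%g i))^-1); split=> [|i].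
  rewrite prodfV; have := lam1.
  by rewrite (reindex_inj (@perm_inj _ s^-1%g)) /= => ->; rewrite invr1.
by rewrite LL' scalerA mulVf ?scale1r ?permKV.
Qed.

Lemma sigma_rel_trans (d : nat) (L1 L2 L3 : multituple d) :
  sigma_rel L1 L2 -> sigma_rel L2 L3 -> sigma_rel L1 L3.
Proof.
move=> [s [lam [lam1 L12]]] [t [mu [mu1 L23]]].
exists (t * s)%g, (fun i => mu i * lam (t i)); split=> [|i].
  rewrite big_split /= mu1 mul1r.
  by have := lam1; rewrite (reindex_inj (@perm_inj _ t)).
by rewrite L23 L12 scalerA permM.
Qed.

Lemma sigma_relP (d : nat) (L L' : multituple d) :
  sigma_rel L L' <->
  clos_refl_sym_trans _ (fun A B => perm_step A B \/ scale_step A B) L L'.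
Proof.
split=> [[s [lam [lam1 LL']]]|].
  apply: (rst_trans _ _ _ (fun i => L (s i) : V1o)).
    by apply: rst_step; left; exists s.
  by apply: rst_step; right; exists lam.
elim=> {L L'} [L L' [[s LL']|[lam lam1 LL']]|L|L L' _|L1 L2 L3 _ + _].
- exists s, (fun=> 1); split=> [|i]; first by rewrite big1.
  by rewrite LL' scale1r.
- by exists 1%g, lam; split=> // i; rewrite perm1.
- exact: sigma_rel_refl.
- exact: sigma_rel_sym.
- exact: sigma_rel_trans.
Qed.

Definition sigma_relb (d : nat) : rel (multituple d) :=
  fun L L' => `[< sigma_rel L L' >].

Lemma sigma_relb_equiv (d : nat) : equiv_class_of (@sigma_relb d).
Proof.
split=> [L|L L'|L2 L1 L3].
- exact/asboolP/sigma_rel_refl.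
- by apply/asboolP/asboolP; apply: sigma_rel_sym.
- by move=> /asboolP L12 /asboolP L23; apply/asboolP/(sigma_rel_trans L12).
Qed.

Canonical sigma_equiv (d : nat) : equiv_rel (multituple d) :=
  EquivRelPack (sigma_relb_equiv d).

Definition multipole (d : nat) : Type :=
  quotient_topology {eq_quot sigma_equiv d}.
HB.instance Definition _ (d : nat) := Topological.on (multipole d).
HB.instance Definition _ (d : nat) := Quotient.on (multipole d).

Definition linprod (d : nat) (L : multituple d) : V d :=
  indhomog d (\prod_i poly_of (linform (L i))).

(* The class of the product modulo Q, represented in the orthogonal complement
   of VQ Q d by means of the orthogonal projection; see PhiQ_pi, PhiQ_mod. *)
Definition PhiQ (d : nat) (ip : {dot V d for Num.conj}) (Q : V 2)
    (m : multipole d) : V d :=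
  daddv_pi (VQperp ip Q) (VQ Q d) (linprod (repr m)).

Lemma linprodE (d : nat) (L : multituple d) :
  poly_of (linprod L) = \prod_i poly_of (linform (L i)).
Proof.
apply: indhomogK; rewrite -[X in ishomog1 X]card_ord -sum1_card.
elim/big_rec2: _ => [|i e p _ hp]; first exact: dhomog1.
by apply: dhomogM; first exact: dhomog_is_dhomog.
Qed.

Lemma linprod_sigma (d : nat) (L L' : multituple d) :
  sigma_rel L L' -> linprod L = linprod L'.
Proof.
move=> [s [lam [lam1 LL']]]; apply: val_inj.
change (poly_of (linprod L) = poly_of (linprod L')); rewrite !linprodE.
under [RHS]eq_bigr do rewrite LL'.
rewrite [RHS](eq_bigr (fun i => lam i *: poly_of (linform (L (s i))))) //.
rewrite scaler_prod lam1 scale1r.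
by rewrite (reindex_inj (@perm_inj _ s)).
Qed.

Lemma PhiQ_pi (d : nat) (ip : {dot V d for Num.conj}) (Q : V 2)
    (L : multituple d) :
  PhiQ ip Q (\pi L) = daddv_pi (VQperp ip Q) (VQ Q d) (linprod L).
Proof.
rewrite /PhiQ; congr (daddv_pi _ _ _); apply: linprod_sigma.
apply/asboolP/(@eqmodP _ (sigma_equiv d)).
exact: (reprK (\pi_(multipole d) L)).
Qed.

Lemma VQperp_cap (d : nat) (ip : {dot V d for Num.conj}) (Q : V 2) :
  (VQperp ip Q :&: VQ Q d = 0)%VS.
Proof.
apply/eqP; rewrite -subv0; apply/subvP => v /memv_capP[/mem_orthovP vp vQ].
rewrite memv0; apply: contraT => /(@neq0_dnorm_gt0 _ _ _ ip).
by rewrite vp ?ltxx.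
Qed.

Lemma VQperp_add (d : nat) (ip : {dot V d for Num.conj}) (Q : V 2) :
  (VQperp ip Q + VQ Q d = fullv)%VS.
Proof.
pose b := vbasis (VQ Q d).
pose f0 (v : V d) : 'rV[K]_(\dim (VQ Q d)) := \row_i ip v b`_i.
have f0_linear : linear f0.
  by move=> c u v; apply/rowP => i; rewrite !mxE linearPl.
pose f : {linear V d -> 'rV[K]_(\dim (VQ Q d))} :=
  HB.pack f0 (GRing.isLinear.Build _ _ _ _ _ f0_linear).
have kerf : (lker (linfun f) <= VQperp ip Q)%VS.
  apply/subvP => v; rewrite memv_ker lfunE => /eqP fv.
  apply/mem_orthovP => u /coord_vbasis ->; rewrite linear_sumr big1 // => i _.
  have := congr1 (fun w : 'rV_ _ => w 0 i) fv; rewrite !mxE => vb.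
  by rewrite linearZr /= vb mulr0.
apply/eqP; rewrite eqEdim subvf dimv_disjoint_sum ?VQperp_cap //.
rewrite -(limg_ker_dim (linfun f) fullv) capfv leq_add ?dimvS //.
by rewrite (leq_trans (dimvS (subvf _))) // dimvf /dim /= mul1n.
Qed.

Lemma PhiQ_mod (d : nat) (ip : {dot V d for Num.conj}) (Q : V 2)
    (L : multituple d) :
  PhiQ ip Q (\pi L) \in VQperp ip Q /\ linprod L - PhiQ ip Q (\pi L) \in VQ Q d.
Proof.
rewrite PhiQ_pi memv_pi; split=> //.
have LV : linprod L \in (VQperp ip Q + VQ Q d)%VS by rewrite VQperp_add memvf.
rewrite -{1}(daddv_pi_add (VQperp_cap ip Q) LV) addrC addKr.
exact: memv_pi.
Qed.
End Multipoles.

Definition D5 (R : realType) : set 'rV[R]_5 :=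
  [set x | \sum_i x ord0 i ^+ 2 <= 1].

Definition S4 (R : realType) : set 'rV[R]_5 :=
  [set x | \sum_i x ord0 i ^+ 2 = 1].

Arguments D5 : clear implicits.
Arguments S4 : clear implicits.

(* h, restricted to A, has a continuous lifting with respect to PhiQ. *)
Definition liftable_on (T : topologicalType) (K : numClosedFieldType) (d : nat)
    (ip : {dot (V K d) for Num.conj}) (Q : V K 2) (A : set T) (h : T -> V K d) :
  Prop :=
  exists g : T -> multipole K d,
    {within A, continuous g} /\ forall x, A x -> PhiQ ip Q (g x) = h x.

(* Main.v *)
Require Import Defs.
From HB Require Import structures.
From mathcomp Require Import all_boot all_order all_algebra perm.
From mathcomp Require Import sesquilinear complex.
From mathcomp Require Import all_classical reals topology normedtype.
From mathcomp Require Import zify ring lra.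
Import Order.TTheory GRing.Theory Num.Theory.
Import numFieldNormedType.Exports.

Set Implicit Arguments.
Unset Strict Implicit.
Unset Printing Implicit Defensive.

Local Open Scope classical_set_scope.
Local Open Scope quotient_scope.
Local Open Scope ring_scope.
Local Open Scope complex_scope.

(** The conic Q = 0 is parametrized by binary forms of degree 2. Pulling back
    along the parametrization kills Q; it turns a form of degree d modulo Q into
    a binary form of degree 2d, and a linear form into a binary quadratic form.
    Writing a form modulo Q as a product of d linear forms therefore amounts to
    grouping the 2d roots of its pullback into d unordered pairs.

    Choose linear forms x, y, z that pull back to 1, t, t^2
    ([conic_parametrization]), and consider the family A - c B, for a complex
    parameter c, where A = y z^(d-1) and B = x^d. Its pullback t^(2d-1) - c has
    a simple root at infinity, and 2d-1 finite roots. In a grouping, the partner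
    of the root at infinity is a (2d-1)-th root of c. It is a polynomial
    function of the linear factors that is invariant under permutations and
    rescalings of product 1 ([unpaired_root]), hence a continuous function on
    the space of multipoles. So a continuous lifting of the family over a set
    of parameters yields a continuous (2d-1)-th root of c over that set, which
    cannot exist along a loop around 0 ([no_root_on_disk]); this uses 2d-1 > 1.

    It remains to let c be a continuous function on the disk of dimension 5 that
    vanishes on the boundary sphere and still winds around 0 inside
    ([plane_coord]). On the sphere the family is then constant, equal to the
    product A of linear forms, which trivially lifts. *)

(** * Diagonalization of symmetric matrices by congruence *)

Lemma sym_form_eq0 (F : fieldType) n (S : 'M[F]_n) : (2%:R : F) != 0 ->
  S^T = S -> (forall u : 'rV_n, u *m S *m u^T = 0) -> S = 0.
Proof.
move=> F2 Ssym S0; apply/matrixP => i j; rewrite [RHS]mxE.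
have E (a b : 'I_n) :
    delta_mx (0 : 'I_1) a *m S *m (delta_mx (0 : 'I_1) b)^T = (S a b)%:M.
  rewrite [LHS]mx11_scalar; congr (_%:M).
  by rewrite -rowE trmx_delta -colE 2!mxE.
have := S0 (delta_mx 0 i + delta_mx 0 j).
rewrite linearD /= !mulmxDl !mulmxDr !S0 add0r addr0 !E.
move/matrixP/(_ 0 0).
rewrite [LHS]mxE [X in X + _]mxE [X in _ + X]mxE [RHS]mxE !mulr1n.
have -> : S j i = S i j by rewrite -[in LHS]Ssym mxE.
rewrite -mulr2n -mulr_natl.
by move/eqP; rewrite mulf_eq0 (negPf F2) => /eqP.
Qed.

(** Gram-Schmidt: split off a vector u with u S u^T nonzero, and diagonalize S
    on the S-orthogonal complement of u. *)
Lemma congruence_diag (F : fieldType) n (S : 'M[F]_n) : (2%:R : F) != 0 ->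
  S^T = S -> exists2 P : 'M[F]_n, P \in unitmx & is_diag_mx (P *m S *m P^T).
Proof.
move=> F2; elim: n S => [|n IHn] S Ssym.
  by exists 1%:M; rewrite ?unitmx1 //; apply/is_diag_mxP => -[].
have [->|/eqP S0] := eqVneq S 0.
  exists 1%:M; rewrite ?unitmx1 // mulmx0 mul0mx.
  by apply/is_diag_mxP => i j _; rewrite mxE.
have [u uSu] : exists u : 'rV_n.+1, u *m S *m u^T != 0.
  apply: contrapT => /forallNP H; apply: S0; apply: sym_form_eq0 => // u.
  by apply/eqP; apply: contraT => /H.
pose q := (u *m S *m u^T) 0 0.
have qE : u *m S *m u^T = q%:M by apply: mx11_scalar.
have q0 : q != 0 by apply: contraNneq uSu => q0; rewrite qE q0 raddf0.
(* The S-orthogonal complement of u is a hyperplane. *)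
have rk : \rank (kermx (S *m u^T)) = n.
  rewrite mxrank_ker -mxrank_tr rank_rV.
  suff -> : (S *m u^T)^T != 0 by rewrite subn1.
  apply: contraNneq uSu => /(congr1 trmx); rewrite trmxK trmx0 => E.
  by rewrite -mulmxA E mulmx0.
have [W Wfree Wker] : exists2 W : 'M_(n, n.+1), row_free W & W *m (S *m u^T) = 0.
  move: (row_base_free (kermx (S *m u^T))) (eq_row_base (kermx (S *m u^T))).
  move: (row_base _); rewrite rk => W Wf Wk; exists W => //.
  by apply/sub_kermxP; rewrite Wk.
have uW : u *m S *m W^T = 0.
  by apply: trmx_inj; rewrite !trmx_mul trmxK Ssym Wker trmx0.
have [P1 P1u P1d] : exists2 P : 'M[F]_n, P \in unitmx &
    is_diag_mx (P *m (W *m S *m W^T) *m P^T).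
  by apply: IHn; rewrite !trmx_mul trmxK Ssym mulmxA.
pose P : 'M_(1 + n, n.+1) := col_mx u (P1 *m W).
have PSP : P *m S *m P^T =
    block_mx (q%:M : 'M_1) 0 0 (P1 *m (W *m S *m W^T) *m P1^T).
  rewrite /P tr_col_mx mul_col_mx mul_col_row trmx_mul !mulmxA uW mul0mx qE.
  by rewrite -!mulmxA Wker !mulmx0.
have := is_diag_block_mx (q%:M : 'M_1) 0 0
  (P1 *m (W *m S *m W^T) *m P1^T) (erefl 1%N).
rewrite -PSP !eqxx scalar_mx_is_diag P1d => PSPd; exists P => {PSP PSPd} //.
rewrite -row_free_unit; apply: (@inj_row_free _ (1 + n) n.+1 P) => v.
rewrite -[v]hsubmxK mul_row_col => vP.
have v10 : lsubmx v = 0.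
  have := congr1 (mulmx^~ (S *m u^T)) vP; rewrite /= mul0mx mulmxDl -!mulmxA Wker.
  rewrite !mulmx0 addr0 (mulmxA u) qE mul_mx_scalar => /eqP.
  by rewrite scaler_eq0 (negPf q0) => /eqP.
move: vP; rewrite v10 mul0mx add0r mulmxA => vP.
have /(row_free_inj Wfree) : rsubmx v *m P1 *m W = 0 *m W.
  by rewrite vP mul0mx.
move/(congr1 (mulmx^~ (invmx P1))); rewrite /= mulmxK // mul0mx => ->.
by rewrite row_mx0.
Qed.

(** * Products of quadratic polynomials of odd degree *)

Lemma coef_prod_top (K : nzRingType) (I : Type) (r : seq I)
    (p : I -> {poly K}) k :
  (forall i, (size (p i) <= k.+1)%N) ->
  (size (\prod_(i <- r) p i)%R <= (k * size r).+1)%N /\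
  (\prod_(i <- r) p i)`_(k * size r) = \prod_(i <- r) (p i)`_k.
Proof.
move=> pk; elim: r => [|i r [IHs IHc]].
  by rewrite !big_nil muln0 coef1 size_poly1.
rewrite !big_cons /= mulnS; split.
  apply: leq_trans (size_polyMleq _ _) _.
  by have := leq_add (pk i) IHs; rewrite addSn addnS; case: (_ + _)%N.
rewrite coefM (bigD1 (inord k)) //= inordK ?ltnS ?leq_addr //.
rewrite addKn IHc [X in _ + X = _]big1 ?addr0 // => j jk.
have [ltjk|] := ltnP j k.
  rewrite [X in _ * X]nth_default ?mulr0 //; apply: leq_trans IHs _.
  by rewrite ltn_subRL ltn_add2r.
rewrite leq_eqVlt => /orP[/eqP kj|ltkj].
  by case/eqP: jk; apply: val_inj; rewrite /= inordK ?ltnS ?leq_addr.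
by rewrite nth_default ?mul0r // (leq_trans (pk i)).
Qed.

(** Since the product has degree 2d-1, one factor has degree 1 and the others
    have degree 2. The sum over i reduces to the term of the factor of degree 1:
    it is a quotient of its coefficients, because the product is monic. *)
Lemma root_of_unpaired_factor (K : idomainType) d (p : 'I_d -> {poly K})
    (z : K) :
  (0 < d)%N -> (forall i, (size (p i) <= 3)%N) ->
  \prod_i p i = 'X^((2 * d).-1) - z%:P ->
  (- \sum_i ((p i)`_0 * \prod_(j | j != i) (p j)`_2)) ^+ (2 * d).-1 = z.
Proof.
move=> d0 p3 pE.
have [_] := coef_prod_top (enum 'I_d) p3.
rewrite size_enum_ord !big_enum /= pE coefB coefXn coefC.
have -> : (2 * d == (2 * d).-1) = false by lia.
have -> : (2 * d == 0)%N = false by lia.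
(* The coefficient of degree 2d of the product vanishes. *)
rewrite subrr => /esym/eqP; rewrite prodf_seq_eq0 => /hasP[i0 _ /= /eqP pi0].
set c := \prod_(j | j != i0) (p j)`_2.
have -> : \sum_i ((p i)`_0 * \prod_(j | j != i) (p j)`_2) = (p i0)`_0 * c.
  rewrite (bigD1 i0) //= [X in _ + X]big1 ?addr0 // => i ii0.
  by rewrite (bigD1 i0) 1?eq_sym //= pi0 mul0r mulr0.
have p0E : p i0 = ((p i0)`_0)%:P + (p i0)`_1 *: 'X.
  apply/polyP => -[|[|[|k]]]; rewrite coefD coefC coefZ coefX /=;
    rewrite ?mulr0 ?mulr1 ?addr0 ?add0r //.
  by rewrite nth_default // (leq_trans (p3 _)).
move: p0E; set a := (p i0)`_0; set b := (p i0)`_1 => p0E.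
set q := \prod_(j | j != i0) p j.
have [q_size q_top] : (size q <= (2 * d.-1).+1)%N /\ q`_(2 * d.-1) = c.
  have := coef_prod_top (enum (predC1 i0)) p3.
  by rewrite -cardE cardC1 card_ord !big_enum /=.
have piq : p i0 * q = 'X^((2 * d).-1) - z%:P by rewrite -pE (bigD1 i0).
have c1 : b * c = 1.
  have := congr1 (fun f : {poly K} => f`_(2 * d).-1) piq.
  rewrite p0E mulrDl coefD coefCM -scalerAl coefZ coefXM coefB coefXn coefC eqxx.
  have -> : ((2 * d).-1 == 0)%N = false by lia.
  rewrite nth_default ?mulr0 ?add0r ?subr0; last by apply: leq_trans q_size _; lia.
  have -> : (2 * d).-1.-1 = (2 * d.-1)%N by lia.
  by rewrite q_top.
have := congr1 (fun f => f.[- (a * c)]) piq.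
rewrite hornerM p0E hornerD hornerZ hornerC hornerX mulrN mulrCA c1 mulr1 subrr mul0r.
by rewrite hornerD hornerN hornerXn hornerC => /esym/eqP; rewrite subr_eq0 => /eqP.
Qed.

(** * Parametrization of an irreducible conic *)

Section Conic.
Variable K : numClosedFieldType.

(** The coordinate functions of the affine space of dimension 3. *)
Definition coord_form (i : 'I_3) : mpoly 3 K := mpolyX K (mnm1 i).

(** Composition of a polynomial in 3 variables with the curve phi, given by its
    three coordinates in the affine parameter t, written 'X. *)
Definition pullback (phi : 'I_3 -> {poly K}) : mpoly 3 K -> {poly K} :=
  mmap polyC phi.
HB.instance Definition _ phi := GRing.RMorphism.on (pullback phi).

Lemma pullbackZ phi c p : pullback phi (c *: p) = c *: pullback phi p.
Proof. by rewrite -mul_mpolyC rmorphM /= /pullback mmapC mul_polyC. Qed.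

Lemma pullback_coord_form phi i : pullback phi (coord_form i) = phi i.
Proof. by rewrite /pullback /coord_form mmapX mmap1U. Qed.

Lemma linear_formE (L : V K 1) :
  poly_of L = \sum_i mcoeff (mnm1 i) (poly_of L) *: coord_form i.
Proof.
apply/mpolyP => m; rewrite linear_sum /=.
have [m1|m1] := eqVneq (mdeg m) 1%N.
  move/eqP: m1; rewrite mdeg_eq1 => /existsP[i /eqP ->].
  rewrite (bigD1 i) //= big1 ?addr0 => [|j ji].
    by rewrite mcoeffZ mcoeffX eqxx mulr1.
  by rewrite mcoeffZ mcoeffX eq_mnm1 (negPf ji) mulr0.
rewrite (dhomog_nemf_coeff (dhomog_is_dhomog L)) // big1 // => i _.
rewrite mcoeffZ mcoeffX; case: eqP => [im|]; last by rewrite mulr0.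
by move: m1; rewrite -im mdeg1.
Qed.

Lemma mdeg2_split (m : multinom 3) : mdeg m = 2%N ->
  exists i j, m = mnm_add (mnm1 i) (mnm1 j).
Proof.
move=> m2; have [i mi] : exists i, m i != 0%N.
  apply: contrapT => /forallNP m0; move: m2; rewrite mdegE big1 // => i _.
  by have := m0 i; case: eqP.
have im := mi; rewrite -lep1mP in im.
have : mdeg (mnm_sub m (mnm1 i)) == 1%N.
  by have := congr1 mdeg (submK im); rewrite mdegD mdeg1 addn1 m2 => -[->].
rewrite mdeg_eq1 => /existsP[j /eqP mj]; exists j, i.
by rewrite -mj submK.
Qed.

Lemma quadratic_formE (Q : V K 2) : exists2 S : 'M[K]_3, S^T = S &
  poly_of Q = \sum_i \sum_j S i j *: (coord_form i * coord_form j).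
Proof.
have [A QA] : exists A : 'M[K]_3,
    poly_of Q = \sum_i \sum_j A i j *: (coord_form i * coord_form j).
  rewrite [poly_of Q]mpolyE big_seq.
  elim/big_ind: _ => [|p q [A ->] [B ->]|m mQ].
  - exists 0; rewrite big1 // => i _; rewrite big1 // => j _.
    by rewrite mxE scale0r.
  - exists (A + B); rewrite -big_split; apply: eq_bigr => i _ /=.
    by rewrite -big_split; apply: eq_bigr => j _ /=; rewrite mxE scalerDl.
  - have [k [l ->]] := mdeg2_split (dhomog_mf (dhomog_is_dhomog Q) mQ).
    set c := mcoeff _ _; exists (c *: delta_mx k l).
    rewrite (bigD1 k) //= [X in _ + X]big1 ?addr0 => [|i ik]; last first.
      by rewrite big1 // => j _; rewrite !mxE (negPf ik) mulr0 scale0r.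
    rewrite (bigD1 l) //= [X in _ + X]big1 ?addr0 => [|j jl]; last first.
      by rewrite !mxE (negPf jl) andbF mulr0 scale0r.
    by rewrite !mxE !eqxx mulr1 mpolyXD.
exists (2^-1 *: (A + A^T)).
  by rewrite linearZ linearD /= trmxK addrC.
have -> : poly_of Q = 2^-1 *: (poly_of Q + poly_of Q).
  by rewrite scalerDr -scalerDl -[2^-1]mul1r -splitr scale1r.
rewrite [X in _ + X]QA exchange_big {1}QA -big_split scaler_sumr.
apply: eq_bigr => i _ /=; rewrite -big_split scaler_sumr.
apply: eq_bigr => j _ /=; rewrite !mxE [coord_form j * _]mulrC -scalerDl.
by rewrite scalerA.
Qed.

Lemma poly_of_zero d : poly_of (0 : V K d) = 0.
Proof. by []. Qed.

Lemma poly_of_add d (p q : V K d) : poly_of (p + q) = poly_of p + poly_of q.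
Proof. by []. Qed.

Lemma poly_of_scale d c (p : V K d) : poly_of (c *: p) = c *: poly_of p.
Proof. by []. Qed.

Lemma poly_of_sub d (p q : V K d) : poly_of (p - q) = poly_of p - poly_of q.
Proof. by []. Qed.

Lemma linear_form_nunit (L : V K 1) : poly_of L \isn't a GRing.unit.
Proof.
apply/negP => /(rmorph_unit (meval (fun=> 0))).
rewrite linear_formE rmorph_sum big1 /= ?unitr0 // => i _.
by rewrite mevalZ mevalXU mulr0.
Qed.

Lemma sum_two_squares_reducible (Q : V K 2) (f g : V K 1) :
  irreducible_elt (poly_of Q) -> poly_of Q <> poly_of f ^+ 2 + poly_of g ^+ 2.
Proof.
move=> [_ _ Qirr] Qfg; suff /Qirr : poly_of Q =
    poly_of (f + 'i *: g) * poly_of (f - 'i *: g).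
  by case; apply/negP; exact: linear_form_nunit.
rewrite Qfg -scaleNr !poly_of_add !poly_of_scale scaleNr mulrC -subr_sqr exprZn.
by rewrite sqrCi scaleN1r opprK.
Qed.

(** An irreducible Q is the sum of the squares of three linear forms that are
    coordinates of the space: the matrix M gives the inverse change of
    coordinates, stated here for curves. *)
Lemma irreducible_sum_squares (Q : V K 2) : irreducible_elt (poly_of Q) ->
  exists (l : 'I_3 -> V K 1) (M : 'M[K]_3),
  poly_of Q = \sum_k poly_of (l k) ^+ 2 /\
  forall phi : 'I_3 -> {poly K}, forall k,
   pullback (fun i => \sum_j M i j *: phi j) (poly_of (l k)) = phi k.
Proof.
move=> Qirr; have [S Ssym QS] := quadratic_formE Q.
have [|P Pu /is_diag_mxP Pdiag] := congruence_diag _ Ssym; first by rewrite pnatr_eq0.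
pose D k := (P *m S *m P^T) k k; pose N := invmx P.
pose r k := sqrtC (D k).
pose l k : V K 1 := indhomog 1 (r k *: \sum_i N i k *: coord_form i).
have lE k : poly_of (l k) = r k *: \sum_i N i k *: coord_form i.
  apply: indhomogK; rewrite rpredZ // rpred_sum // => i _.
  by rewrite rpredZ // dhomogX; apply/eqP/mdeg1.
have QE : poly_of Q = \sum_k poly_of (l k) ^+ 2.
  rewrite QS; have -> : S = N *m (P *m S *m P^T) *m N^T.
    by rewrite !mulmxA mulVmx // mul1mx -mulmxA -trmx_mul mulVmx // trmx1 mulmx1.
  have NDN i j : (N *m (P *m S *m P^T) *m N^T) i j =
      \sum_k D k * (N i k * N j k).
    rewrite mxE; apply: eq_bigr => k _; rewrite !mxE (bigD1 k) //= big1 ?addr0.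
      by rewrite mulrAC [_ * D k]mulrC mulrA.
    by move=> k' k'k; rewrite Pdiag ?mulr0.
  under eq_bigr => i _ do under eq_bigr => j _ do rewrite NDN scaler_suml.
  under eq_bigr => i _ do rewrite exchange_big /=.
  rewrite exchange_big /=; apply: eq_bigr => k _.
  rewrite lE exprZn sqrtCK expr2 mulr_suml scaler_sumr; apply: eq_bigr => i _.
  rewrite mulr_sumr scaler_sumr; apply: eq_bigr => j _.
  rewrite -[_ * (_ *: coord_form j)]scalerAr.
  rewrite -[(_ *: coord_form i) * _]scalerAl !scalerA.
  by rewrite -!mulrA [N j k * _]mulrC.
(* If one square is missing, Q is a sum of two squares, which factors. *)
have r0 k : r k != 0.
  apply/eqP => rk0; have lk0 : poly_of (l k) = 0 by rewrite lE rk0 scale0r.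
  apply: (@sum_two_squares_reducible Q (l (k + 1)) (l (k + 2%:R)) Qirr).
  rewrite QE (reindex_inj (addrI k)) !big_ord_recl big_ord0 !addr0 /=.
  rewrite lk0 expr2 mul0r add0r addr0.
  have -> : lift ord0 ord0 = 1 :> 'I_3 by apply: val_inj.
  by have -> : lift ord0 (lift ord0 ord0) = 2%:R :> 'I_3 by apply: val_inj.
exists l, (\matrix_(i, k) (P k i / r k)); split=> // phi k.
have PN j : \sum_i N i k * (P j i / r j) = (j == k)%:R / r j.
  have <- : (P *m N) j k = (j == k)%:R by rewrite mulmxV // mxE.
  by rewrite mxE mulr_suml; apply: eq_bigr => i _; rewrite mulrCA mulrA.
rewrite lE pullbackZ rmorph_sum /=.
under eq_bigr => i _ do rewrite pullbackZ pullback_coord_form scaler_sumr.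
rewrite exchange_big /= (bigD1 k) //= [X in _ + X]big1 ?addr0 => [|j jk].
  under eq_bigr => i _ do rewrite mxE scalerA.
  by rewrite -scaler_suml PN eqxx mul1r scalerA mulfV ?scale1r.
under eq_bigr => i _ do rewrite mxE scalerA.
by rewrite -scaler_suml PN (negPf jk) mul0r scale0r.
Qed.

(** In coordinates where Q is a sum of three squares, the curve is
    ((1 - t^2) / 2, - 'i (1 + t^2) / 2, t). *)
Lemma conic_parametrization (Q : V K 2) : irreducible_elt (poly_of Q) ->
  exists (phi : 'I_3 -> {poly K}) (x y z : V K 1),
    [/\ forall i, (size (phi i) <= 3)%N,
        pullback phi (poly_of Q) = 0 &
        [/\ pullback phi (poly_of x) = 1, pullback phi (poly_of y) = 'X &
            pullback phi (poly_of z) = 'X^2]].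
Proof.
move=> /irreducible_sum_squares[l [M [QE lM]]].
pose h : K := 2^-1.
pose g (k : 'I_3) : {poly K} :=
  [:: h *: (1 - 'X^2); - 'i *: (h *: (1 + 'X^2)); 'X]`_k.
pose phi i := \sum_j M i j *: g j.
have lg k : pullback phi (poly_of (l k)) = g k by apply: lM.
have h2 : h + h = 1 by rewrite /h -[2^-1]mul1r -splitr.
have g3 k : (size (g k) <= 3)%N.
  have h3 (p : {poly K}) c : (size p <= 3)%N -> (size (c *: (1 + p)) <= 3)%N.
    move=> p3; apply: leq_trans (size_scale_leq _ _) _.
    by rewrite (leq_trans (size_polyD _ _)) // geq_max size_poly1.
  rewrite /g; case: k => [[|[|[|k]]] lk] //=; last by rewrite size_polyX.
    by rewrite h3 // size_polyN size_polyXn.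
  by apply: leq_trans (size_scale_leq _ _) _; rewrite h3 // size_polyXn.
exists phi, (l 0 + 'i *: l 1), (l 2%:R), ('i *: l 1 - l 0); split.
- move=> i; apply: (leq_trans (size_sum _ _ _)); apply/bigmax_leqP => j _.
  apply: leq_trans (size_scale_leq _ _) _; apply: g3.
- rewrite QE rmorph_sum /= !big_ord_recl big_ord0 !rmorphXn /= !lg /g /=.
  rewrite addr0 !exprZn sqrrN sqrCi scaleN1r addrA -scalerBr.
  have -> : (1 - 'X^2) ^+ 2 - (1 + 'X^2) ^+ 2 = - (4%:R *: 'X^2) :> {poly K}.
    by rewrite -mul_polyC; ring.
  have h4 : h ^+ 2 * 4%:R = 1.
    by rewrite /h exprVn -natrX mulVf // pnatr_eq0.
  by rewrite scalerN scalerA h4 scale1r addNr.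
split.
- rewrite poly_of_add poly_of_scale rmorphD /= pullbackZ !lg /g /=.
  rewrite scalerA mulrN -expr2 sqrCi opprK scale1r -scalerDr addrACA addNr.
  by rewrite addr0 scalerDr -scalerDl h2 scale1r.
- by rewrite lg.
- rewrite poly_of_add -scaleN1r !poly_of_scale rmorphD /= !pullbackZ !lg /g /=.
  rewrite scaleN1r scalerA mulrN -expr2 sqrCi opprK scale1r -scalerBr.
  have -> : 1 + 'X^2 - (1 - 'X^2) = 'X^2 + 'X^2 :> {poly K} by ring.
  by rewrite scalerDr -scalerDl h2 scale1r.
Qed.
End Conic.

(** * Continuity *)

Lemma comp_continuous (T U W : topologicalType) (f : T -> U) (g : U -> W) :
  continuous f -> continuous g -> continuous (fun x => g (f x)).
Proof. by move=> fc gc x; apply: continuous_comp; [exact: fc | exact: gc]. Qed.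

Lemma within_comp_continuous (T U W : topologicalType) (A : set T) (B : set U)
    (f : T -> U) (g : U -> W) :
  continuous f -> (forall x, A x -> B (f x)) -> {within B, continuous g} ->
  {within A, continuous (fun x => g (f x))}.
Proof.
move=> fc AB /subspace_continuousP gc; apply/subspace_continuousP => x Ax P.
move=> /(gc _ (AB _ Ax)) H.
have H' : nbhs x (f @^-1` [set y | B y -> P (g y)]) by apply: fc; exact: H.
by rewrite /= /within /=; apply: filterS H' => y /= HP /AB; exact: HP.
Qed.

Section FieldValued.
Variable K : numFieldType.

Lemma mul_fun_continuous (T : topologicalType) (f g : T -> K) :
  continuous f -> continuous g -> continuous (fun x => f x * g x).
Proof. by move=> fc gc x; apply: cvgM; [exact: fc | exact: gc]. Qed.

Lemma opp_fun_continuous (T : topologicalType) (f : T -> K) :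
  continuous f -> continuous (fun x => - f x).
Proof. by move=> fc x; apply: cvgN; exact: fc. Qed.

Lemma sum_fun_continuous (T : topologicalType) (I : Type) (r : seq I) (P : pred I)
    (F : I -> T -> K) : (forall i, P i -> continuous (F i)) ->
  continuous (fun x => \sum_(i <- r | P i) F i x).
Proof.
by move=> Fc; apply: continuous_big => //; exact: add_continuous.
Qed.

Lemma prod_fun_continuous (T : topologicalType) (I : Type) (r : seq I) (P : pred I)
    (F : I -> T -> K) : (forall i, P i -> continuous (F i)) ->
  continuous (fun x => \prod_(i <- r | P i) F i x).
Proof.
move=> Fc; apply: continuous_big => // z.
by apply: cvgM; [exact: cvg_fst | exact: cvg_snd].
Qed.

Lemma add_fun_continuous (T : topologicalType) (f g : T -> K) :
  continuous f -> continuous g -> continuous (fun x => f x + g x).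
Proof. by move=> fc gc x; apply: cvgD; [exact: fc | exact: gc]. Qed.

Lemma exp_fun_continuous (T : topologicalType) (f : T -> K) n :
  continuous f -> continuous (fun x => f x ^+ n).
Proof.
move=> fc; have -> : (fun x => f x ^+ n) = (fun x => \prod_(i < n) f x).
  by apply/funext => x; rewrite prodr_const card_ord.
exact: prod_fun_continuous.
Qed.

Lemma inv_fun_continuous (T : topologicalType) (f : T -> K) :
  (forall x, f x != 0) -> continuous f -> continuous (fun x => (f x)^-1).
Proof. by move=> f0 fc x; apply: cvgV; [exact: f0 | exact: fc]. Qed.

Lemma within_mul_continuous (T : topologicalType) (A : set T)
    (f g : T -> K) :
  {within A, continuous f} -> {within A, continuous g} ->
  {within A, continuous (fun x => f x * g x)}.
Proof. by move=> fc gc x; apply: cvgM; [exact: fc | exact: gc]. Qed.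

End FieldValued.

Lemma continuous_eps_delta (K1 K2 : numFieldType) (f : K1 -> K2) :
  (forall x e, 0 < e ->
    exists2 r, 0 < r & forall y, `|x - y| < r -> `|f x - f y| < e) ->
  continuous f.
Proof.
move=> fc x; apply: (cvgrPdist_lt (FF := nbhs_filter x) f (f x)).2 => e.
move=> /(fc x)[r r0 H].
by apply/nbhs_ballP; exists r => // y; exact: H.
Qed.

Section ComplexTopology.
Variable R : realType.
Local Notation C := (R[i] : numClosedFieldType).

Lemma real_complex_continuous : continuous (fun x : R => x%:C : C).
Proof.
apply: continuous_eps_delta => x [r j]; rewrite ltcE /= => /andP[/eqP -> r0].
exists r => // y xy.
by rewrite -rmorphB normc_def /= expr0n addr0 sqrtr_sqr ltcR.
Qed.

Lemma Re_continuous : continuous (@complex.Re R : C -> R).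
Proof.
apply: (@continuous_eps_delta C R) => z e e0; exists e%:C; first by rewrite ltcR.
move=> t /= zt; rewrite -raddfB -ltcR.
exact: le_lt_trans (normc_ge_Re _) zt.
Qed.

Lemma Im_continuous : continuous (@complex.Im R : C -> R).
Proof.
have -> : @complex.Im R = fun z => complex.Re (- 'i * z).
  by apply/funext => -[a b]; rewrite mulNr /=; simpc.
apply: comp_continuous Re_continuous.
by apply: mul_fun_continuous => // x; [exact: cst_continuous | exact: cvg_id].
Qed.

Lemma min_fun_continuous (T : topologicalType) (f g : T -> R) :
  continuous f -> continuous g -> continuous (fun x => Num.min (f x) (g x)).
Proof. by move=> fc gc x; exact: (@continuous_min R T f g x (fc x) (gc x)). Qed.

Lemma complex_fun_continuous (T : topologicalType) (f g : T -> R) :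
  continuous f -> continuous g -> continuous (fun x => f x +i* g x : C).
Proof.
move=> fc gc; have -> : (fun x => f x +i* g x : C) =
    (fun x => (f x)%:C + 'i%C * (g x)%:C).
  by apply/funext => x; rewrite [LHS]complexE.
apply: (@add_fun_continuous C).
  exact: (@comp_continuous T R C f (fun r => r%:C) fc real_complex_continuous).
apply: (@mul_fun_continuous C); first exact: cst_continuous.
exact: (@comp_continuous T R C g (fun r => r%:C) gc real_complex_continuous).
Qed.

End ComplexTopology.

Section MultipoleTopology.
Variable K : numClosedFieldType.

Lemma coef_continuous d m : continuous (fun p : V K d => mcoeff m (poly_of p)).
Proof.
move=> p; apply: (@continuous_comp _ _ _ (@coefs K d) (@proj _ (fun=> K) m)).
  exact: initial_continuous.
exact: proj_continuous.
Qed.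

Lemma continuous_to_V (T : topologicalType) d (f : T -> V K d) :
  (forall m, continuous (fun x => mcoeff m (poly_of (f x)))) -> continuous f.
Proof.
move=> fc; apply: continuous_comp_initial => x; apply/cvg_sup => m.
exact: (continuous_comp_initial (fc m :
  continuous ((fun g : _ -> K => g m) \o (@coefs K d \o f)))).
Qed.

(** * The partner of the root at infinity *)

Variables (phi : 'I_3 -> {poly K}) (d : nat).

Lemma pullback_coef_continuous k :
  continuous (fun L : V1o K => (pullback phi (poly_of (linform L)))`_k).
Proof.
have -> : (fun L : V1o K => (pullback phi (poly_of (linform L)))`_k) =
    (fun L => \sum_i mcoeff (mnm1 i) (poly_of (linform L)) * (phi i)`_k).
  apply/funext => L; rewrite {1}linear_formE rmorph_sum coef_sum /=.
  by apply: eq_bigr => i _; rewrite pullbackZ pullback_coord_form coefZ.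
apply: sum_fun_continuous => i _; apply: mul_fun_continuous;
  last exact: cst_continuous.
move=> L; apply: (@continuous_comp _ _ _ (@linform K)
  (fun p => mcoeff (mnm1 i) (poly_of p))); last exact: coef_continuous.
exact: initial_continuous.
Qed.

(** When exactly one of the quadratic polynomials obtained by pulling back the
    forms L i has degree less than 2, and their product is monic of degree 2d-1,
    this is the root of the one of degree 1; see [root_of_unpaired_factor]. This
    polynomial expression is chosen because it is defined, continuous and
    invariant on all tuples. *)
Definition unpaired_root (L : multituple K d) : K :=
  - \sum_i ((pullback phi (poly_of (linform (L i))))`_0 *
      \prod_(j | j != i) (pullback phi (poly_of (linform (L j))))`_2).

Lemma unpaired_root_continuous : continuous unpaired_root.
Proof.
have coefc k i : continuous (fun L : multituple K d =>
    (pullback phi (poly_of (linform (L i))))`_k).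
  apply: (@comp_continuous (multituple K d) (V1o K) K (@proj _ (fun=> V1o K) i)
    (fun L : V1o K => (pullback phi (poly_of (linform L)))`_k)).
    exact: proj_continuous.
  exact: pullback_coef_continuous.
apply: opp_fun_continuous; apply: sum_fun_continuous => i _.
apply: mul_fun_continuous; first exact: coefc.
by apply: prod_fun_continuous => j _; exact: coefc.
Qed.

Lemma unpaired_root_sigma (L L' : multituple K d) :
  sigma_rel L L' -> unpaired_root L = unpaired_root L'.
Proof.
move=> [s [lam [lam1 LL']]]; congr (- _).
have E i k : (pullback phi (poly_of (linform (L' i))))`_k =
    lam i * (pullback phi (poly_of (linform (L (s i)))))`_k.
  by rewrite LL' poly_of_scale pullbackZ coefZ.
rewrite (reindex_inj (@perm_inj _ s)); apply: eq_bigr => i _ /=.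
rewrite E (reindex_inj (@perm_inj _ s)) /=.
under [X in _ = _ * X]eq_bigr do rewrite E.
have lami : lam i * \prod_(j | j != i) lam j = 1.
  by rewrite -[RHS]lam1 [RHS](bigD1 i).
rewrite big_split /= mulrACA lami mul1r; congr (_ * _).
by apply: eq_bigl => j; rewrite (inj_eq perm_inj).
Qed.

(** [unpaired_root] descends to a continuous function on multipoles. *)
Lemma unpaired_root_repr_continuous :
  continuous (fun m : multipole K d => unpaired_root (repr m)).
Proof.
apply: (repr_comp_continuous unpaired_root_continuous) => L L' /eqP LL'.
apply/eqP/unpaired_root_sigma/asboolP.
exact/(@eqmodP _ (sigma_equiv K d)).
Qed.

End MultipoleTopology.

(** * No continuous odd root over the disk *)

(** A continuous function on a segment with values in a finite set is
    constant. *)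
Lemma continuous_unity_root_const (R : realType) (K : numClosedFieldType) n
    (q : R -> K) : (0 < n)%N -> {within `[0, 1], continuous q} ->
  (forall s : R, s \in `[0, 1] -> q s ^+ n = 1) -> q 0 = q 1.
Proof.
move=> n0 qc q1.
have conn := connected_continuous_connected (@segment_connected R 0 1) qc.
have I0 : (q @` `[0, 1]) (q 0) by exists 0 => //=; rewrite in_itv /= lexx ler01.
have I1 : (q @` `[0, 1]) (q 1) by exists 1 => //=; rewrite in_itv /= lexx ler01.
suff qI : q @` `[0, 1] = [set q 0] by move: I1; rewrite qI => ->.
have closedfin : forall A : set K, finite_set A -> closed A.
  by apply/accessible_finite_set_closed/hausdorff_accessible/norm_hausdorff.
have finU : finite_set [set x : K | x ^+ n = 1].
  have [r rE] := closed_field_poly_normal ('X^n - 1%:P : {poly K}).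
  have pn0 : ('X^n - 1%:P : {poly K}) != 0 by rewrite -size_poly_eq0 size_XnsubC.
  apply: sub_finite_set (finite_seq r) => x /= xn.
  rewrite -root_prod_XsubC -(rootZ _ _ (_ : lead_coef ('X^n - 1%:P) != 0)).
    2: by rewrite lead_coef_eq0.
  by rewrite -rE; apply/rootP; rewrite hornerD hornerN hornerXn hornerC xn subrr.
apply/esym/conn; first by exists (q 0).
- exists (~` ([set x : K | x ^+ n = 1] `\ q 0)).
    apply: closed_openC; apply: closedfin; apply: (sub_finite_set _ finU).
    exact: subDsetl.
  apply/seteqP; split=> [_ ->|x [[s s01 <-] /= H]].
    by split=> // -[_]; apply.
  by apply: contrapT => sne; apply: H; split=> //; exact: q1.
- exists [set q 0]; first by apply: closedfin; apply: finite_set1.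
  by apply/esym/setIidr => x ->.
Qed.

Lemma nontrivial_unity_root (K : numClosedFieldType) n : (1 < n)%N ->
  exists2 zeta : K, zeta ^+ n = 1 & zeta != 1.
Proof.
move=> n1; pose p : {poly K} := \poly_(i < n) 1.
have sp : size p = n by rewrite size_poly_eq // oner_eq0.
have [|zeta] := closed_rootP p _; first by rewrite sp neq_ltn n1 orbT.
rewrite /root horner_poly => /eqP zeta0; exists zeta.
  apply/eqP; rewrite -subr_eq0 subrX1; apply/eqP.
  rewrite [X in _ * X](eq_bigr (fun i : 'I_n => 1 * zeta ^+ i)) => [|i _].
    by rewrite zeta0 mulr0.
  by rewrite mul1r.
apply/eqP => z1; move: zeta0.
rewrite z1 (eq_bigr (fun=> 1)) => [|i _]; last by rewrite expr1n mulr1.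
by move/eqP; rewrite sumr_const card_ord pnatr_eq0; case: n n1 {p sp}.
Qed.

Section Disk.
Variable R : realType.
Local Notation C := (R[i] : numClosedFieldType).

(** The first two real coordinates of a point of the disk, as a complex number,
    times a cutoff that is 1 on the ball of squared radius 1/2, and 0 on the
    boundary sphere. *)
Definition plane_coord (x : 'rV[R]_5) : C :=
  (Num.min 1 (2 * (1 - \sum_i x ord0 i ^+ 2)))%:C * (x ord0 0 +i* x ord0 1).

Lemma plane_coord_S4 x : S4 R x -> plane_coord x = 0.
Proof.
by rewrite /S4 /plane_coord /= => ->; rewrite subrr mulr0 min_r ?ler01 // mul0r.
Qed.

Lemma plane_coord_continuous : continuous plane_coord.
Proof.
apply: mul_fun_continuous.
  apply: (comp_continuous (g := fun r : R => r%:C : C));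
    last exact: real_complex_continuous.
  apply: min_fun_continuous; first exact: cst_continuous.
  apply: mul_fun_continuous; first exact: cst_continuous.
  apply: add_fun_continuous; first exact: cst_continuous.
  apply: opp_fun_continuous; apply: sum_fun_continuous => i _.
  by apply: exp_fun_continuous; exact: coord_continuous.
by apply: complex_fun_continuous; exact: coord_continuous.
Qed.

(** Along the loop [w ^+ n], where w runs along the segment from 1 to a
    nontrivial n-th root of unity zeta, halved, a continuous n-th root is a
    constant multiple of w; but w does not return to its starting point. As n is odd, zeta is not
    negative, so the segment avoids 0. *)
Lemma no_root_on_disk n (r : 'rV[R]_5 -> C) : odd n -> (1 < n)%N ->
  {within D5 R, continuous r} ->
  ~ (forall x, D5 R x -> r x ^+ n = plane_coord x).
Proof.
move=> n_odd n1 rc rn; have [zeta zn zeta1] := nontrivial_unity_root R[i] n1.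
have n0 : (0 < n)%N by apply: ltnW.
have zeta_norm : `|zeta| = 1.
  by apply/eqP; rewrite -(pexpr_eq1 n0) // -normrX zn normr1.
pose w (s : R) : C := ((1 - s)%:C + s%:C * zeta) / 2%:R.
(* Otherwise zeta is a real number of odd power 1, thus 1. *)
have w_neq0 s : w s != 0.
  rewrite mulf_neq0 ?invr_eq0 ?pnatr_eq0 //; apply/eqP => ws.
  have [s0|s0] := eqVneq s 0.
    by move: ws; rewrite s0 subr0 mul0r addr0 => /eqP; rewrite oner_eq0.
  pose t := (s - 1) / s.
  have zetaE : zeta = t%:C.
    apply: (@mulfI _ s%:C); first by rewrite fmorph_eq0.
    rewrite -rmorphM /= mulrCA mulfV // mulr1.
    by apply/eqP; rewrite -subr_eq0 -rmorphN opprB /= addrC ws.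
  have tn : t ^+ n = 1 by apply: complexI; rewrite rmorphXn rmorph1 /= -zetaE.
  have : `|t| == 1 by rewrite -(pexpr_eq1 n0) // -normrX tn normr1.
  rewrite eqr_norml ler01 andbT => /orP[/eqP t1|/eqP t1].
    by move: zeta1; rewrite zetaE t1 eqxx.
  move: tn; rewrite t1 -signr_odd n_odd expr1 => /eqP.
  by rewrite eq_sym -subr_eq0 opprK -mulr2n pnatr_eq0.
have RCc (f : R -> R) : continuous f -> continuous (fun s => (f s)%:C : C).
  by move=> fc; apply: (comp_continuous fc); exact: real_complex_continuous.
have wc : continuous w.
  apply: mul_fun_continuous; last exact: cst_continuous.
  apply: add_fun_continuous.
    apply: RCc; apply: add_fun_continuous; first exact: cst_continuous.
    by apply: opp_fun_continuous => ?; exact: cvg_id.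
  apply: mul_fun_continuous; last exact: cst_continuous.
  by apply: RCc => ?; exact: cvg_id.
pose z s := w s ^+ n.
have zc : continuous z by apply: exp_fun_continuous.
(* The factor 1/2 in w keeps the loop in the region where the cutoff is 1. *)
pose loop s : 'rV[R]_5 :=
  complex.Re (z s) *: delta_mx ord0 0 + complex.Im (z s) *: delta_mx ord0 1.
have loopc : continuous loop.
  move=> s; apply: cvgD; apply: cvgZr_tmp.
    exact: (comp_continuous zc (@Re_continuous R)).
  exact: (comp_continuous zc (@Im_continuous R)).
have loop_norm s : \sum_i loop s ord0 i ^+ 2 =
    complex.Re (z s) ^+ 2 + complex.Im (z s) ^+ 2.
  rewrite !big_ord_recl big_ord0 /loop !mxE /=.
  by rewrite !(mulr0, mulr1, add0r, addr0, expr0n).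
have z_norm s : s \in `[0, 1] ->
    complex.Re (z s) ^+ 2 + complex.Im (z s) ^+ 2 <= 1 / 4.
  rewrite in_itv /= => /andP[s0 s1].
  have w12 : `|w s| <= 2^-1.
    rewrite normrM normfV [`|2%:R|]ger0_norm ?ler0n // ler_pdivrMr ?ltr0n //.
    rewrite mulVf ?pnatr_eq0 //.
    apply: le_trans (ler_normD _ _) _; rewrite normrM zeta_norm mulr1.
    by rewrite !ger0_norm ?ler0c ?subr_ge0 // -rmorphD /= subrK.
  have z12 : `|z s| <= 2^-1.
    rewrite normrX -(prednK n0) exprS -[leRHS]mulr1 ler_pM ?exprn_ge0 //.
    by rewrite exprn_ile1 // (le_trans w12) // invf_le1 ?ler1n ?ltr0n.
  rewrite -lecR add_Re2_Im2.
  have -> : (1 / 4)%:C = 2^-1 ^+ 2 :> R[i].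
    by rewrite mul1r fmorphV /= rmorph_nat exprVn -natrX.
  by rewrite lerXn2r ?nnegrE ?invr_ge0 ?ler0n.
have loop_D5 s : s \in `[0, 1] -> D5 R (loop s).
  by move=> /z_norm; rewrite /D5 /= loop_norm; lra.
have loop_coord s : s \in `[0, 1] -> plane_coord (loop s) = z s.
  move=> s01; rewrite /plane_coord loop_norm min_l; last first.
    by have := z_norm s s01; lra.
  rewrite mul1r /loop !mxE /= !(mulr0, mulr1, add0r, addr0).
  by case: (z s).
pose q s := r (loop s) / w s.
have qc : {within `[0, 1], continuous q}.
  apply: (@within_mul_continuous C R `[0, 1]%classic
    (fun s => r (loop s)) (fun s => (w s)^-1)).
    exact: (within_comp_continuous loopc loop_D5 rc).
  have wVc := @inv_fun_continuous C R w w_neq0 wc.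
  by apply: continuous_subspaceT; exact: wVc.
have qn s : s \in `[0, 1] -> q s ^+ n = 1.
  move=> s01; rewrite exprMn exprVn rn; last exact: loop_D5.
  by rewrite (loop_coord s s01) mulfV // expf_neq0 // w_neq0.
have := continuous_unity_root_const n0 qc qn.
have w0 : w 0 = 2%:R^-1 by rewrite /w subr0 rmorph1 rmorph0 mul0r addr0 mul1r.
have w1 : w 1 = zeta / 2%:R by rewrite /w subrr rmorph1 rmorph0 add0r mul1r.
have loop01 : loop 0 = loop 1.
  have z01 : z 0 = z 1.
    by rewrite /z w0 w1 exprMn zn mul1r.
  by rewrite /loop z01.
rewrite /q -loop01 w0 w1.
have I0 : (0 : R) \in `[0, 1] by rewrite in_itv /= lexx ler01.
have r0 : r (loop 0) != 0.
  apply/eqP => r0; have := rn _ (loop_D5 _ I0); rewrite loop_coord // r0 expr0n.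
  by rewrite gtn_eqF // => /esym/eqP; rewrite expf_eq0 n0 (negPf (w_neq0 _)).
move/(mulfI r0)/invr_inj => E; case/eqP: zeta1.
have two0 : (2%:R : R[i])^-1 != 0 by rewrite invr_eq0 pnatr_eq0.
by apply: (mulIf two0); rewrite mul1r -E.
Qed.

End Disk.

(** * Liftings over the space of forms modulo Q *)

Section Restriction.
Variable K : numClosedFieldType.
Variables (Q : V K 2) (d : nat) (d_ge2 : (2 <= d)%N).
Variable ip : {dot (V K d) for Num.conj}.
Variable phi : 'I_3 -> {poly K}.
Hypothesis phi3 : forall i, (size (phi i) <= 3)%N.
Hypothesis phiQ : pullback phi (poly_of Q) = 0.

(** The projection onto the complement of the multiples of Q, which represents
    a form by its class modulo Q. *)
Definition perp_proj : 'End(V K d) := daddv_pi (VQperp ip Q) (VQ Q d).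

Lemma perp_proj_mem p : perp_proj p \in VQperp ip Q.
Proof. exact: memv_pi. Qed.

Lemma perp_proj_mod p : p - perp_proj p \in VQ Q d.
Proof.
have pV : p \in (VQperp ip Q + VQ Q d)%VS by rewrite VQperp_add memvf.
rewrite -{1}(daddv_pi_add (VQperp_cap ip Q) pV) addrC addKr.
exact: memv_pi.
Qed.

Lemma pullback_VQ (p : V K d) : p \in VQ Q d -> pullback phi (poly_of p) = 0.
Proof.
by move=> /(mem_VQ _ _ d_ge2)[q ->]; rewrite rmorphM /= phiQ mul0r.
Qed.

Lemma pullback_perp_proj p :
  pullback phi (poly_of (perp_proj p)) = pullback phi (poly_of p).
Proof.
have := pullback_VQ (perp_proj_mod p); rewrite poly_of_sub rmorphB /= => /eqP.
by rewrite subr_eq0 => /eqP.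
Qed.

Lemma pullback_linprod (L : multituple K d) :
  pullback phi (poly_of (linprod L)) = \prod_i pullback phi (poly_of (linform (L i))).
Proof. by rewrite linprodE rmorph_prod. Qed.

Lemma pullback_linear_size (L : V K 1) : (size (pullback phi (poly_of L)) <= 3)%N.
Proof.
rewrite linear_formE rmorph_sum /=.
apply: (leq_trans (size_sum _ _ _)); apply/bigmax_leqP => j _.
by rewrite pullbackZ pullback_coord_form (leq_trans (size_scale_leq _ _)).
Qed.

(** The roots of t^(2d-1) - z are those of the pullbacks of the linear forms
    that lift p, because p and their product agree on the conic. *)
Lemma unpaired_root_lift (m : multipole K d) (p : V K d) z :
  pullback phi (poly_of p) = 'X^((2 * d).-1) - z%:P ->
  PhiQ ip Q m = perp_proj p ->
  unpaired_root phi (repr m) ^+ (2 * d).-1 = z.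
Proof.
move=> pE mp; apply: root_of_unpaired_factor; first exact: ltnW.
  by move=> i; exact: pullback_linear_size.
rewrite -pullback_linprod -pullback_perp_proj.
by rewrite -[perp_proj _]/(PhiQ ip Q m) mp pullback_perp_proj.
Qed.

End Restriction.

Lemma V1o_surj (K : numClosedFieldType) (L : V K 1) : L != 0 ->
  exists L' : V1o K, linform L' = L.
Proof. by move=> L0; exists (exist _ L (mem_set L0)). Qed.

Theorem corollary8 (R : realType) (Q : V R[i] 2)
    (Qirr : irreducible_elt (poly_of Q)) (d : nat) (d_ge2 : (2 <= d)%N)
    (ip : {dot (V R[i] d) for Num.conj}) :
  exists h : 'rV[R]_5 -> V R[i] d,
    [/\ {within D5 R, continuous h},
        forall x, D5 R x -> h x \in VQperp ip Q /\ h x != 0,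
        ~ liftable_on ip Q (D5 R) h &
        liftable_on ip Q (S4 R) h].
Proof.
have [phi [x [y [z [phi3 phiQ [phix phiy phiz]]]]]] := conic_parametrization Qirr.
have neq0 (L : V R[i] 1) : pullback phi (poly_of L) != 0 -> L != 0.
  by apply: contraNneq => ->; rewrite poly_of_zero rmorph0.
have [X XE] : exists X : V1o R[i], linform X = x.
  by apply: V1o_surj; rewrite neq0 // phix oner_eq0.
have [Y YE] : exists Y : V1o R[i], linform Y = y.
  by apply: V1o_surj; rewrite neq0 // phiy polyX_eq0.
have [Z ZE] : exists Z : V1o R[i], linform Z = z.
  by apply: V1o_surj; rewrite neq0 // phiz monic_neq0 // monicXn.
(* A = y z^(d-1) and B = x^d. *)
pose LA : multituple R[i] d := fun i => if val i == 0%N then Y else Z.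
pose A := linprod LA; pose B := linprod (fun _ : 'I_d => X : V1o R[i]).
have phiB : pullback phi (poly_of B) = 1.
  by rewrite pullback_linprod big1 // => i _; rewrite XE.
have phiA : pullback phi (poly_of A) = 'X^((2 * d).-1).
  have d0 : (0 < d)%N by apply: ltnW.
  rewrite pullback_linprod (bigD1 (Ordinal d0)) //= {1}/LA /= YE phiy.
  rewrite (eq_bigr (fun=> 'X^2)) => [|i i0]; last first.
    by rewrite /LA ifN ?ZE.
  rewrite prodr_const cardC1 card_ord -exprM -exprS; congr ('X^_); lia.
pose family (u : 'rV[R]_5) : V R[i] d := A - plane_coord u *: B.
have phi_family u : pullback phi (poly_of (family u)) =
    'X^((2 * d).-1) - (plane_coord u)%:P.
  rewrite /family poly_of_sub poly_of_scale rmorphB /= pullbackZ phiA phiB.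
  by rewrite alg_polyC.
pose pr := perp_proj Q ip.
have hE u : pr (family u) = pr A - plane_coord u *: pr B by rewrite linearB linearZ.
exists (fun u => pr (family u)); split.
- apply: continuous_subspaceT; apply: continuous_to_V => m.
  have -> : (fun u => mcoeff m (poly_of (pr (family u)))) =
      (fun u => mcoeff m (poly_of (pr A)) +
        - (plane_coord u * mcoeff m (poly_of (pr B)))).
    by apply/funext => u; rewrite hE poly_of_sub poly_of_scale mcoeffB mcoeffZ.
  apply: (@add_fun_continuous R[i]); first exact: cst_continuous.
  apply: (@opp_fun_continuous R[i]); apply: (@mul_fun_continuous R[i]).
    exact: plane_coord_continuous.
  exact: cst_continuous.
- move=> u _; split; first exact: perp_proj_mem.
  apply: contraTneq isT => /(congr1 (fun p => pullback phi (poly_of p))).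
  rewrite pullback_perp_proj // phi_family poly_of_zero rmorph0.
  by move/eqP; rewrite -size_poly_eq0 size_XnsubC //; lia.
- move=> [g [gc gh]].
  apply: (@no_root_on_disk R (2 * d).-1
    (fun u => unpaired_root phi (repr (g u)))).
  + have -> : (2 * d).-1 = (d.-1).*2.+1 by lia.
    by rewrite /= odd_double.
  + lia.
  + exact: (@comp_continuous (subspace (D5 R)) _ _ g _ gc
      (@unpaired_root_repr_continuous _ phi d)).
  + move=> u uD.
    exact: (unpaired_root_lift d_ge2 phi3 phiQ (phi_family u) (gh u uD)).
(* On the sphere the family is constant, equal to the class of A. *)
- exists (fun=> \pi_(multipole R[i] d) LA); split.
    by apply: continuous_subspaceT; exact: cst_continuous.
  by move=> u uS; rewrite PhiQ_pi /pr /family plane_coord_S4 // scale0r subr0.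
Qed.
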